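(* The key poset on weak compositions of length $n$ is ranked by $\mathrm{rk}$, and its covering relation is: $\mathbf{a}\prec\!\!\!\cdot\,\mathbf{b}$ if and only if $\mathbf{b}$ is obtained from $\mathbf{a}$ by incrementing a single entry $a_j$ by $1$ (so $b_j=a_j+1$ and $b_k=a_k$ for $k\ne j$) where $a_i\neq a_j+1$ for every $i<j$.
   Context: A weak composition of length $n$ is a sequence $\mathbf{a}=(a_1,\dots,a_n)$ of nonnegative integers, with rank $\mathrm{rk}(\mathbf{a})=a_1+\cdots+a_n$. The key poset is the partial order on weak compositions of length $n$ given by $\mathbf{a}\preceq\mathbf{b}$ iff $a_i\le b_i$ for all $i$ and, for all indices $1\le i<j\le n$ with $b_j>a_j$ and $a_i>a_j$, we have $b_i>b_j$. In a poset, $q$ covers $p$ ($p\prec\!\!\!\cdot\, q$) if $p\prec q$ and there is no $r$ with $p\prec r\prec q$. *)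

(* Defs.v *)
From HB Require Import structures.
From mathcomp Require Import all_boot all_order.

Set Implicit Arguments.
Unset Strict Implicit.
Unset Printing Implicit Defensive.

Import Order.TTheory.

Definition covers (d : Order.disp_t) (T : porderType d) (p q : T) : Prop :=
  (p < q)%O /\ ~ exists r : T, (p < r < q)%O.

Definition minimal (d : Order.disp_t) (T : porderType d) (m : T) : Prop :=
  forall x : T, (x <= m)%O -> x = m.

(* The monotonicity clause is not redundant for a general poset, where a       *)
(* comparable pair need not be joined by a chain of covers.                    *)
Definition ranked_by (d : Order.disp_t) (T : porderType d) (rho : T -> nat) :
    Prop :=
  [/\ forall m : T, minimal m -> rho m = 0,
      forall p q : T, (p < q)%O -> rho p < rho q
    & forall p q : T, covers p q -> rho q = (rho p).+1].

(* An alias, so that the key order does not compete with other orders on       *)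
(* finite functions.                                                           *)
Definition wcomp (n : nat) : Type := {ffun 'I_n -> nat}.

HB.instance Definition _ (n : nat) := Choice.on (wcomp n).

Definition rk (n : nat) (a : wcomp n) : nat := \sum_(i < n) a i.

Definition key_le (n : nat) (a b : wcomp n) : bool :=
  [forall i : 'I_n, a i <= b i] &&
  [forall i : 'I_n, forall j : 'I_n,
     [&& i < j, a j < b j & a j < a i] ==> (b j < b i)].

Lemma key_leP (n : nat) (a b : wcomp n) :
  reflect ((forall i : 'I_n, a i <= b i) /\
           (forall i j : 'I_n,
              i < j -> a j < b j -> a j < a i -> b j < b i))
          (key_le a b).
Proof.
apply: (iffP andP) => -[/= H1 H2]; split.
- exact/forallP.
- move=> i j ij ajb aji.
  by move/forallP/(_ i)/forallP/(_ j)/implyP: H2; apply; apply/and3P.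
- exact/forallP.
- apply/forallP => i; apply/forallP => j; apply/implyP => /and3P[ij ajb aji].
  exact: H2.
Qed.

Lemma key_le_refl (n : nat) : reflexive (@key_le n).
Proof. by move=> a; apply/key_leP; split=> // i j _; rewrite ltnn. Qed.

Lemma key_le_anti (n : nat) : antisymmetric (@key_le n).
Proof.
move=> a b /andP[/key_leP[ab _] /key_leP[ba _]].
by apply/ffunP => i; apply/eqP; rewrite eqn_leq ab ba.
Qed.

Lemma key_le_trans (n : nat) : transitive (@key_le n).
Proof.
move=> b a c /key_leP[ab Hab] /key_leP[bc Hbc]; apply/key_leP; split.
  by move=> i; apply: leq_trans (ab i) (bc i).
move=> i j ij ajc aji.
have bji : b j < c j -> b j < b i -> c j < c i by exact: Hbc.
have [ajb|bja] := ltnP (a j) (b j).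
  have bij := Hab i j ij ajb aji.
  have [|cjb] := ltnP (b j) (c j); first by move/bji; apply.
  exact: leq_ltn_trans cjb (leq_trans bij (bc i)).
have ltb : b j < b i by apply: leq_ltn_trans bja (leq_trans aji (ab i)).
by apply: bji => //; apply: leq_ltn_trans bja ajc.
Qed.

Fact key_display : Order.disp_t. Proof. exact: Order.Disp tt tt. Qed.

HB.instance Definition _ (n : nat) :=
  Order.Le_isPOrder.Build key_display (wcomp n)
    (@key_le_refl n) (@key_le_anti n) (@key_le_trans n).

Lemma wcomp_leE (n : nat) (a b : wcomp n) : (a <= b)%O = key_le a b.
Proof. by []. Qed.

(* Main.v *)
(* If a < b, then among the entries where a and b differ choose one with      *)
(* maximal a-value, and the rightmost of these.  Incrementing that entry of a *)
(* gives an admissible step that stays below b.  Hence covers are exactly the *)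
(* admissible steps, and these raise rk by one.                               *)
Require Import Defs.
From HB Require Import structures.
From mathcomp Require Import all_boot all_order.
From mathcomp Require Import zify.

Import Order.TTheory.

(** Everything rests on [incr_le_of_lt]: each strict relation starts with an admissible step.
    Iterated, it would climb from [a] to [b] one unit of rank at a time; a single application
    already makes [rk] strictly monotone and forces a cover to be one step. Conversely, a step
    raises [rk] by one, which leaves no room in between. *)

Definition incr {n : nat} (a : wcomp n) (j : 'I_n) : wcomp n :=
  [ffun k => a k + (k == j)].

Definition admissible {n : nat} (a : wcomp n) (j : 'I_n) : Prop :=
  forall i : 'I_n, i < j -> a i <> a j + 1.

Lemma incrE {n : nat} {a b : wcomp n} (j : 'I_n) :
  b = incr a j <->
  b j = a j + 1 /\ forall k : 'I_n, k <> j -> b k = a k.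
Proof.
split=> [->|[bj bk]].
  by split=> [|k /eqP/negPf kj]; rewrite ffunE ?eqxx // kj addn0.
apply/ffunP => k; rewrite ffunE; have [->//|/eqP kj] := eqVneq k j.
by rewrite addn0 bk.
Qed.

Lemma rk_incr (n : nat) (a : wcomp n) (j : 'I_n) :
  rk (incr a j) = (rk a).+1.
Proof.
rewrite /rk (eq_bigr (fun k => a k + (k == j))) => [|k _]; last by rewrite ffunE.
rewrite big_split /= [X in _ + X](bigD1 j) //= eqxx.
by rewrite [X in _ + (_ + X)]big1 ?addn1 // => k /negPf ->.
Qed.

Lemma rk_le {n : nat} {a b : wcomp n} : (a <= b)%O -> rk a <= rk b.
Proof. by case/key_leP => ab _; apply: leq_sum. Qed.

(** Only pairs ending at [j] matter: from [a j < a i], admissibility excludes [a i = a j + 1], so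
    [a i] still exceeds the raised entry. *)
Lemma lt_incr (n : nat) (a : wcomp n) (j : 'I_n) :
  admissible a j -> (a < incr a j)%O.
Proof.
move=> adm; rewrite lt_def; apply/andP; split.
  by apply/eqP => /(congr1 (@rk n)); rewrite rk_incr; lia.
apply/key_leP; split=> [i|i k ik]; rewrite !ffunE; first exact: leq_addr.
have [kj|] := eqVneq k j; last by lia.
by rewrite kj in ik *; have := adm i ik; lia.
Qed.

Lemma incr_le_of_lt {n : nat} {a b : wcomp n} :
  (a < b)%O -> exists2 j, admissible a j & (incr a j <= b)%O.
Proof.
rewrite lt_def => /andP[/eqP neq_ba /key_leP[ab key_ab]].
have [j0 j0D] : exists j0, a j0 < b j0.
  apply/existsP; apply: contra_notT neq_ba => /existsPn ba.
  by apply/ffunP => k; apply/eqP; rewrite eqn_leq leqNgt ba ab.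
have [m mD mmax] :=
  @arg_maxnP _ j0 (fun j => a j < b j) (fun j => a j) j0D.
have mP : (a m < b m) && (a m == a m) by rewrite mD eqxx.
have [j /andP[jD /eqP ajm] jmax] :=
  @arg_maxnP _ m (fun j => (a j < b j) && (a j == a m)) (fun j => j : nat) mP.
exists j => [i ij aij|].
  (* The key condition gives [b j < b i]. By maximality of [a j], the larger entry [a i] is
     unchanged in [b], so [b i = a j + 1 <= b j], a contradiction. *)
  have ji : a j < a i by lia.
  have := key_ab i j ij jD ji; have := mmax i; lia.
apply/key_leP; split=> [i|i k ik]; rewrite !ffunE.
  by have [->|_] := eqVneq i j; have := ab i; lia.
have key_ik := key_ab i k ik; have amk := mmax k; have jk := jmax k.
(* When [i = j], raising [a j] could newly constrain only [k > j] with [a k = a j] and [a k < b k];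
   [j] being rightmost rules this out. *)
have [ei|_] := eqVneq i j; last by lia.
rewrite ei in ik key_ik *; lia.
Qed.

Lemma rk_lt {n : nat} {a b : wcomp n} : (a < b)%O -> rk a < rk b.
Proof. by case/incr_le_of_lt => j _ /rk_le; rewrite rk_incr. Qed.

Lemma coversE {n : nat} {a b : wcomp n} :
  covers a b <-> exists2 j, admissible a j & b = incr a j.
Proof.
split=> [[ab no_mid]|[j adm ->]].
  have [j adm jb] := incr_le_of_lt ab; exists j => //.
  apply/eqP; apply: contra_notT no_mid => nb.
  by exists (incr a j); rewrite lt_incr // lt_def nb.
split; first exact: lt_incr.
by case=> r /andP[/rk_lt ar /rk_lt]; rewrite rk_incr; lia.
Qed.

Lemma rk_minimal (n : nat) (m : wcomp n) : minimal m -> rk m = 0.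
Proof.
(* The zero composition lies below every [m], so a minimal [m] equals it. *)
move=> /(_ [ffun=> 0]) <-; first by apply: big1 => i _; rewrite ffunE.
by apply/key_leP; split=> [i|i j _]; rewrite !ffunE.
Qed.

Theorem theorem2p3 (n : nat) :
  ranked_by (@rk n) /\
  (forall a b : wcomp n,
     covers a b <->
     exists j : 'I_n,
       [/\ b j = a j + 1,
           forall k : 'I_n, k <> j -> b k = a k
         & forall i : 'I_n, i < j -> a i <> a j + 1]).
Proof.
split; first split; [exact: rk_minimal | by move=> a b; apply: rk_lt | |].
  by move=> a b /coversE[j _ ->]; apply: rk_incr.
move=> a b; split=> [/coversE[j adm /incrE[bj bk]]|[j [bj bk adm]]].
  by exists j.
by apply/coversE; exists j => //; apply/incrE.
Qed.
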